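(* Let $q$ be a power of $2$ and let $B\subset\mathbb{P}^2$ be the Ballico-Hefez curve over $\mathbb{F}_q$, i.e. the image of $\Phi:\mathbb{P}^1\to\mathbb{P}^2$, $\Phi(s,t)=(s^{q+1},\,s^{q}t+st^{q},\,t^{q+1})$. For each integer $i\ge 0$ let $\tau_i$ be the number of $\mathbb{F}_q$-lines $l$ in $\mathbb{P}^2$ with $\#\left(B(\mathbb{F}_q)\cap l\right)=i$. Then: (i) The $q+1$ points of $B(\mathbb{F}_q)\setminus\mathrm{Sing}\,B$ are collinear. (ii) If $\tau_i\neq 0$, then $i=1$ or $i=\frac{q}{2}+1$ or $i=q+1$. (iii) $\tau_1=q+1$; $\tau_{\frac{q}{2}+1}=q^2-1$; $\tau_{q+1}=1$.
   Context: $B(\mathbb{F}_q)$ is the set of points of $B$ in $\mathbb{P}^2(\mathbb{F}_q)$, and $\mathrm{Sing}\,B$ is the set of singular points of $B$ (over $\overline{\mathbb{F}}_q$). An $\mathbb{F}_q$-line is a line of $\mathbb{P}^2$ defined over $\mathbb{F}_q$. *)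

(* Defs.v *)
From HB Require Import structures.
From mathcomp Require Import all_boot all_order all_algebra all_field.
From mathcomp Require Import boolp.
From mathcomp Require Import mpoly.

Set Implicit Arguments.
Unset Strict Implicit.
Unset Printing Implicit Defensive.
Import GRing.Theory.
Local Open Scope ring_scope.

(* P^2(K) and its dual: points are the 1-dimensional subspaces of K^3, lines
   are the 2-dimensional ones, and incidence is inclusion.  For a subfield F
   of K, [line F] is the set of lines of P^2 defined over F. *)
Definition grass (K : fieldType) (d : nat) : Type :=
  {V : {vspace 'rV[K]_3} | \dim V == d}.
Definition point (K : fieldType) : Type := grass K 1.
Definition line (K : fieldType) : Type := grass K 2.

Module FiniteSubspaces.
Import VectorInternalTheory.
HB.instance Definition _ (F : finFieldType) (vT : vectType F) :=
  [Countable of {vspace vT} by <:].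
HB.instance Definition _ (F : finFieldType) (vT : vectType F) :=
  [Finite of {vspace vT} by <:].
End FiniteSubspaces.
HB.export FiniteSubspaces.

HB.instance Definition _ (F : finFieldType) (d : nat) :=
  Finite.copy (grass F d) {V : {vspace 'rV[F]_3} | \dim V == d}.
HB.instance Definition _ (F : finFieldType) := Finite.copy (point F) (grass F 1).
HB.instance Definition _ (F : finFieldType) := Finite.copy (line F) (grass F 2).

Definition incident (K : fieldType) (p : point K) (l : line K) : bool :=
  (sval p <= sval l)%VS.

Lemma map_point_subproof (F K : fieldType) (iota : {rmorphism F -> K})
    (p : point F) :
  \dim <[map_mx iota (vpick (sval p))]>%VS == 1%N.
Proof.
by rewrite dim_vline map_mx_eq0 vpick0 -dimv_eq0 (eqP (svalP p)).
Qed.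

(* The inclusion P^2(F) -> P^2(K): [vpick V] is a nonzero vector of V. *)
Definition map_point (F K : fieldType) (iota : {rmorphism F -> K})
    (p : point F) : point K :=
  exist (fun V => is_true (\dim V == 1%N)) _ (map_point_subproof iota p).

Definition vanishes_at (K : fieldType) (f : {mpoly K[3]}) (p : point K) : Prop :=
  forall v : 'rV[K]_3, v \in sval p -> v != 0 -> f.@[v ord0] = 0.

(* The Jacobian criterion for a plane curve C over an algebraically closed
   field: all first partial derivatives of all forms in the homogeneous ideal
   of C vanish at p.  When this ideal is generated by a single form f, it
   amounts to the vanishing at p of the partial derivatives of f. *)
Definition singular (K : closedFieldType) (C : point K -> Prop) (p : point K) :
    Prop :=
  C p /\
  forall (d : nat) (f : {mpoly K[3]}), f \is d.-homog ->
    (forall r : point K, C r -> vanishes_at f r) ->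
    forall i : 'I_3, vanishes_at f^`M(i) p.

Definition Phi (K : fieldType) (q : nat) (s t : K) : 'rV[K]_3 :=
  \row_j [:: s ^+ q.+1; s ^+ q * t + s * t ^+ q; t ^+ q.+1]`_j.

Definition ballico_hefez (K : fieldType) (q : nat) (p : point K) : Prop :=
  exists s t : K, (s, t) != (0, 0) /\ sval p = <[Phi q s t]>%VS.

(* The F-points of C are all the points of P^2(F) lying on C; for the curve
   above, these are not only the images of the points of P^1(F). *)
Definition rat_points (F : finFieldType) (K : fieldType)
    (iota : {rmorphism F -> K}) (C : point K -> Prop) : {set point F} :=
  [set p | `[< C (map_point iota p) >]].

Definition rat_sing (F : finFieldType) (K : closedFieldType)
    (iota : {rmorphism F -> K}) (C : point K -> Prop) : {set point F} :=
  [set p | `[< singular C (map_point iota p) >]].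

Definition collinear (F : finFieldType) (A : {set point F}) : Prop :=
  exists l : line F, forall p, p \in A -> incident p l.

Definition tau (F : finFieldType) (A : {set point F}) (i : nat) : nat :=
  #|[set l : line F | #|[set p in A | incident p l]| == i]|.

(* Main.v *)
Require Import Defs.
From HB Require Import structures.
From mathcomp Require Import all_boot all_order all_algebra all_field.
From mathcomp Require Import boolp zify ring.
From mathcomp Require Import mpoly.
Set Implicit Arguments.
Unset Strict Implicit.
Unset Printing Implicit Defensive.
Import GRing.Theory.
Local Open Scope ring_scope.

(** The proof rests on a description of the rational points of the curve by
    the additive subgroup N = {w^2 + w} of F, which has index 2.

    Rational points.  If [X : Y : Z] = Phi(1, t) then t is a root of
    X T^2 + Y T + Z, the other root being t^q.  A rational point with Y = 0 is
    therefore always on B: it is the image of a point of P^1(F).  A rational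
    point with Y <> 0 is on B exactly when t^q is the conjugate of t over F,
    that is, when the quadratic polynomial is irreducible over F; scaling to
    [x : 1 : z], this means that x z is not in N ([on_curve_affine]).

    Smoothness.  A point with x z outside N has the two distinct parameters
    t and t^q, with distinct tangents.  A form vanishing on B has a
    differential killed by both tangent vectors and by the vector of the point
    itself, so it is singular there ([singular_node]).  The points with Y = 0
    are smooth because B lies on the curve
      Y^(q+1) + X^q Z + X Z^q + sum_(i < n) (X Z)^(2^i) Y^(q+1-2^(i+1)) = 0,
    which restricts to X^q Z + X Z^q on Y = 0 and so has partial derivatives
    Z^q and X^q there ([smooth_infinite]).  Hence the smooth rational points
    are the q + 1 rational points of the line Y = 0 ([smoothE]).

    Lines.  A line a X + b Y + c Z = 0 other than Y = 0 meets Y = 0 in one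
    point.  On its other points, x z is a polynomial of degree at most 2
    without constant term in a parameter m, and a square c m^2 = (d m)^2 is
    congruent to d m modulo N; so x z is congruent to k m for some constant k,
    and k vanishes exactly when b^2 = a c.  Thus the line has q/2 further
    points of B if k <> 0 and none otherwise ([card_norm_line]).  The lines
    with k = 0 form a conic in the dual plane, with q + 1 rational points, and
    the three values of tau follow. *)

(** * Forms along polynomial curves *)

(** A nonzero p would make p * 'X + 1 nonconstant, so this polynomial would
    have a root, at which it equals 1. *)
Lemma closed_field_poly0 (K : closedFieldType) (p : {poly K}) :
  (forall t, p.[t] = 0) -> p = 0.
Proof.
move=> p0; apply/eqP/negPn/negP => pN0.
have /closed_rootP [t] : size (p * 'X + 1%:P) != 1%N.
  by rewrite size_MXaddC (negPf pN0) eqSS size_poly_eq0.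
by rewrite /root !hornerE p0 mul0r add0r oner_eq0.
Qed.

(** The chain rule.  Both sides are derivations in f that agree on constants
    and on the variables. *)
Lemma deriv_mmap (R : comNzRingType) (n : nat) (g : 'I_n -> {poly R})
    (f : {mpoly R[n]}) :
  (mmap polyC g f)^`() =
  \sum_(i < n) mmap polyC g f^`M(i) * (g i)^`().
Proof.
pose P f := (mmap polyC g f)^`() =
  \sum_(i < n) mmap polyC g f^`M(i) * (g i)^`().
have PD f1 f2 : P f1 -> P f2 -> P (f1 + f2).
  rewrite /P mmapD derivD => -> ->; rewrite -big_split /=; apply: eq_bigr => i _.
  by rewrite mderivD mmapD mulrDl.
have PC c : P c%:MP.
  by rewrite /P mmapC derivC big1 // => i _; rewrite mderivC mmap0 mul0r.
have PM f1 f2 : P f1 -> P f2 -> P (f1 * f2).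
  rewrite /P rmorphM derivM => -> ->.
  rewrite mulr_suml mulr_sumr -big_split /=; apply: eq_bigr => i _.
  by rewrite mderivM mmapD !rmorphM /=; ring.
have PX i : P 'X_i.
  rewrite /P mmapX mmap1U (bigD1 i) //= big1 ?addr0 => [|j ji].
    by rewrite mderivX mnm1E eqxx scale1r -[X in (X - _)%MM]add0m addmK
               mpolyX0 rmorph1 mul1r.
  by rewrite mderivX mnm1E eq_sym (negPf ji) scale0r mmap0 mul0r.
rewrite -/(P f) (mpolyE f); apply: (big_ind P) => [|f1 f2|m _].
- by have := PC 0; rewrite mpolyC0.
- exact: PD.
rewrite -mul_mpolyC mpolyXE_id; apply: (PM); first exact: (PC).
apply: (big_ind P) => [|g1 g2|i _]; [exact: (PC 1) | exact: (PM) |].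
by elim: (m i) => [|k IHk]; [exact: (PC 1) | rewrite exprS; apply: (PM)].
Qed.

Lemma horner_mmap (R : comNzRingType) (n : nat) (g : 'I_n -> {poly R})
    (f : {mpoly R[n]}) t :
  (mmap polyC g f).[t] = f.@[fun i => (g i).[t]].
Proof.
rewrite mevalE /mmap horner_sum; apply: eq_bigr => m _.
rewrite hornerM hornerC horner_prod; congr (_ * _).
by apply: eq_bigr => i _; rewrite horner_exp.
Qed.

(** If f vanishes along the curve g, then the velocity of g is tangent to
    f = 0.  The value u = 0 is exempted so that g may be a line through the
    origin, where the vanishing of f says nothing about projective points. *)
Lemma tangent_to_zero_locus (K : closedFieldType) (n : nat)
    (f : {mpoly K[n]}) (g : 'I_n -> {poly K}) t :
  (forall u, u != 0 -> f.@[fun i => (g i).[u]] = 0) ->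
  \sum_(i < n) f^`M(i).@[fun i => (g i).[t]] * (g i)^`().[t] = 0.
Proof.
move=> fg0; have fg : mmap polyC g f = 0.
  have /mulIf : 'X != 0 :> {poly K} by rewrite polyX_eq0.
  apply; rewrite mul0r; apply: closed_field_poly0 => u.
  rewrite hornerM hornerX horner_mmap.
  by have [->|/fg0 ->] := eqVneq u 0; rewrite ?mulr0 ?mul0r.
have := congr1 (horner^~ t) (deriv_mmap g f).
rewrite fg deriv0 horner0 horner_sum => /esym fg'0; rewrite -[RHS]fg'0.
by apply: eq_bigr => i _; rewrite hornerM horner_mmap.
Qed.

Lemma mevalZ_homog (R : comNzRingType) (n d : nat) (f : {mpoly R[n]})
    (v : 'I_n -> R) k :
  f \is d.-homog -> f.@[fun i => k * v i] = k ^+ d * f.@[v].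
Proof.
move=> fd; rewrite !mevalE mulr_sumr; apply: eq_big_seq => m mf /=.
rewrite (eq_bigr (fun i => k ^+ m i * v i ^+ m i)) => [|i _]; last exact: exprMn.
rewrite big_split /= prodrXr -mdegE.
by rewrite (dhomog_mf fd mf) mulrCA.
Qed.

(** * Characteristic two *)

Lemma deriv_Xq (R : nzRingType) q :
  q%:R = 0 :> R -> ('X^q)^`() = 0 :> {poly R}.
Proof. by move=> q0; rewrite derivXn -scaler_nat q0 scale0r. Qed.

Lemma deriv_XqS (R : nzRingType) q :
  q%:R = 0 :> R -> ('X^(q.+1))^`() = 'X^q :> {poly R}.
Proof. by move=> q0; rewrite derivXn mulrS -scaler_nat q0 scale0r addr0. Qed.

Section Char2.
Variables (R : comNzRingType).
Hypothesis R2 : 2%N \in [pchar R].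

(** This reduces an identity in characteristic 2 to one that holds in every
    commutative ring, once half of the difference of its sides is given. *)
Lemma char2_eq z (x y : R) : x = y + 2 * z -> x = y.
Proof. by move=> ->; rewrite (pcharf0 R2) mul0r addr0. Qed.

Lemma frobeniusD n (x y : R) :
  (x + y) ^+ (2 ^ n) = x ^+ (2 ^ n) + y ^+ (2 ^ n).
Proof.
apply: exprDn_pchar.
by rewrite (eq_pnat _ (pcharf_eq R2)) pnatX pnat_id.
Qed.

(** With w = a / (a + b), the quotient ab / (a + b)^2 is w^2 + w, so that the
    sum of its powers of exponent 2^i telescopes to w^(2^n) + w; multiplying by
    (a + b)^(2^n + 1) gives the identity.  The induction on n covers the case
    a + b = 0 as well. *)
Lemma artin_schreier_sum (n : nat) (a b : R) :
  \sum_(i < n) (a * b) ^+ (2 ^ i) * (a + b) ^+ (2 ^ n - 2 ^ i.+1).+1 =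
  a ^+ (2 ^ n) * b + a * b ^+ (2 ^ n).
Proof.
elim: n => [|n IHn].
  by rewrite big_ord0 !expr1 addrr_pchar2.
rewrite big_ord_recr /= subnn expr1.
rewrite (eq_bigr (fun i : 'I_n => (a + b) ^+ (2 ^ n) *
   ((a * b) ^+ (2 ^ i) * (a + b) ^+ (2 ^ n - 2 ^ i.+1).+1))); last first.
  move=> i _; rewrite mulrCA -exprD; congr (_ * _ ^+ _).
  by rewrite addnS addnBA ?leq_exp2l // addnn -mul2n -expnS.
rewrite -mulr_sumr IHn frobeniusD expnS mulnC !exprM exprMn.
move: (a ^+ _) (b ^+ _) => u v.
have R20 : 2 = 0 :> R by exact: pcharf0 R2.
ring: R20.
Qed.

End Char2.

Lemma artin_schreier_roots (R : idomainType) (a b : R) :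
  2%N \in [pchar R] -> a ^+ 2 + a = b ^+ 2 + b -> a = b \/ a = b + 1.
Proof.
move=> R2 ab; have R20 : 2 = 0 :> R by exact: pcharf0 R2.
have /eqP : (a - b) * (a - (b + 1)) = 0.
  rewrite (_ : _ * _ = a ^+ 2 + a - (b ^+ 2 + b) + 2 * (b ^+ 2 + b - a - a * b)).
    by rewrite ab subrr R20 mul0r addr0.
  by ring.
by rewrite mulf_eq0 !subr_eq0 => /orP[] /eqP; [left | right].
Qed.

Lemma artin_schreier_solvable (K : closedFieldType) (c : K) :
  exists a, a ^+ 2 + a = c.
Proof.
have /closed_rootP [a] : size ('X^2 + ('X - c%:P)) != 1%N.
  by rewrite size_polyDl size_polyXn ?size_XsubC.
by rewrite /root !hornerE subr_eq0 => /eqP; exists a.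
Qed.

(** The polynomial 'X^q - 'X splits over F, and its roots there are all the
    elements of F. *)
Lemma fixed_by_frobenius (F : finFieldType) (K : fieldType)
    (iota : {rmorphism F -> K}) (a : K) :
  a ^+ #|F| = a -> exists w, a = iota w.
Proof.
move=> aF; have := congr1 (horner^~ a \o map_poly iota) (finField_genPoly F).
rewrite /= rmorphB rmorph_prod /= map_polyXn map_polyX !hornerE aF subrr.
rewrite horner_prod => /esym/eqP; rewrite prodf_seq_eq0 => /hasP[w _] /=.
rewrite rmorphB /= map_polyX map_polyC !hornerE subr_eq0 => /eqP ->.
by exists w.
Qed.

Section ArtinSchreier.
Variables (F : finFieldType).
Hypothesis F2 : 2%N \in [pchar F].

(** This is the kernel of the absolute trace of F: a is of this form exactly
    when 'X^2 + 'X + a splits over F. *)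
Definition artin_schreier : {set F} := [set w ^+ 2 + w | w : F].

Lemma artin_schreier_mem w : w ^+ 2 + w \in artin_schreier.
Proof. exact: imset_f. Qed.

Lemma artin_schreierD u w :
  (u + (w ^+ 2 + w) \in artin_schreier) = (u \in artin_schreier).
Proof.
have R20 : 2 = 0 :> F by exact: pcharf0 F2.
apply/imsetP/imsetP => -[v _ uv]; exists (v + w) => //.
  have -> : u = v ^+ 2 + v + (w ^+ 2 + w).
    by rewrite -uv -addrA addrr_pchar2 // addr0.
  by ring: R20.
by rewrite uv; ring: R20.
Qed.

(** Each value of w^2 + w is taken exactly twice, at w and w + 1. *)
Lemma card_artin_schreier : (#|artin_schreier| * 2)%N = #|F|.
Proof.
rewrite -[RHS]sum1_card (partition_big_imset (fun w : F => w ^+ 2 + w)) /=.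
rewrite -sum_nat_const; apply: eq_bigr => _ /imsetP[w _ ->].
rewrite sum1_card (eq_card (B := [set w; w + 1])) => [|v].
  by rewrite cards2 -subr_eq0 opprD addNKr oppr_eq0 oner_eq0.
rewrite !inE; apply/eqP/orP => [/(artin_schreier_roots F2)[] ->|[] /eqP ->] //.
- by left.
- by right.
- by apply: (char2_eq F2 (z := w + 1)); ring.
Qed.

Lemma card_scaled_not_artin_schreier k :
  #|[set m | k * m \notin artin_schreier]| = if k == 0 then 0%N else (#|F| %/ 2)%N.
Proof.
case: eqP => [-> | /eqP k0].
  apply: eq_card0 => m; rewrite inE mul0r.
  by have := artin_schreier_mem 0; rewrite expr0n addr0 => ->.
have -> : [set m | k * m \notin artin_schreier] = *%R k @^-1: (~: artin_schreier).
  by apply/setP => m; rewrite !inE.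
rewrite on_card_preimset; last first.
  apply: onW_bij; exists ( *%R k^-1); [exact: mulKf | exact: mulVKf].
rewrite cardsCs setCK -card_artin_schreier mulnK //.
by rewrite muln2 -addnn addnK.
Qed.

End ArtinSchreier.

(** * Homogeneous coordinates *)

Definition vec (R : pzSemiRingType) (x y z : R) : 'rV[R]_3 :=
  \row_j [:: x; y; z]`_j.

Lemma ord3P (P : 'I_3 -> Prop) : P 0 -> P 1 -> P 2 -> forall i, P i.
Proof.
move=> P0 P1 P2 [[|[|[|//]]] lti].
- by rewrite (_ : Ordinal lti = 0) //; apply: val_inj.
- by rewrite (_ : Ordinal lti = 1) //; apply: val_inj.
- by rewrite (_ : Ordinal lti = 2) //; apply: val_inj.
Qed.

Lemma big_ord3 (R : nmodType) (G : 'I_3 -> R) :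
  \sum_(i < 3) G i = G 0 + G 1 + G 2.
Proof.
rewrite !big_ord_recl big_ord0 addr0 addrA.
by congr (_ + G _ + G _); apply: val_inj.
Qed.

Lemma vecE (R : pzSemiRingType) (x y z : R) :
  ((vec x y z ord0 0 = x) * (vec x y z ord0 1 = y) * (vec x y z ord0 2 = z))%type.
Proof. by rewrite !mxE. Qed.

Lemma vec_inj (R : pzSemiRingType) (x y z x' y' z' : R) :
  vec x y z = vec x' y' z' -> [/\ x = x', y = y' & z = z'].
Proof.
move=> e; have E i := congr1 (fun v : 'rV_3 => v ord0 i) e.
by have := (E 0, E 1, E 2); rewrite !vecE => -[[-> ->] ->].
Qed.

Lemma rV3_vec (R : pzSemiRingType) (v : 'rV[R]_3) :
  v = vec (v ord0 0) (v ord0 1) (v ord0 2).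
Proof. by apply/rowP; apply: ord3P; rewrite vecE. Qed.

Lemma vec_eq0 (R : pzSemiRingType) (x y z : R) :
  (vec x y z == 0) = [&& x == 0, y == 0 & z == 0].
Proof.
apply/eqP/and3P => [e|[/eqP-> /eqP-> /eqP->]].
  have E i := congr1 (fun v : 'rV_3 => v ord0 i) e.
  by have := (E 0, E 1, E 2); rewrite !vecE !mxE => -[[-> ->] ->].
by apply/rowP; apply: ord3P; rewrite vecE mxE.
Qed.

Lemma scale_vec (R : pzSemiRingType) (k x y z : R) :
  k *: vec x y z = vec (k * x) (k * y) (k * z).
Proof. by apply/rowP; apply: ord3P; rewrite mxE !vecE. Qed.

Lemma map_vec (R S : pzSemiRingType) (h : R -> S) x y z :
  map_mx h (vec x y z) = vec (h x) (h y) (h z).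
Proof. by apply/rowP; apply: ord3P; rewrite mxE !vecE. Qed.

Lemma PhiE (K : fieldType) q (s t : K) :
  Phi q s t = vec (s ^+ q.+1) (s ^+ q * t + s * t ^+ q) (t ^+ q.+1).
Proof. by []. Qed.

Lemma vline_scale (K : fieldType) (vT : vectType K) (k : K) (v : vT) :
  k != 0 -> (<[k *: v]> = <[v]>)%VS.
Proof.
move=> k0; apply: subv_anti; rewrite -!memvE memvZ ?memv_line //=.
by rewrite -[X in X \in _](scalerK k0) memvZ ?memv_line.
Qed.

Lemma vline_eq (K : fieldType) (vT : vectType K) (u v : vT) :
  u != 0 -> (<[u]> = <[v]>)%VS -> exists2 k, k != 0 & u = k *: v.
Proof.
move=> u0 uv; have /vlineP[k uk] : u \in <[v]>%VS by rewrite -uv memv_line.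
by exists k => //; apply: contraNneq u0 => k0; rewrite uk k0 scale0r.
Qed.

Definition point_of (K : fieldType) (v : 'rV[K]_3) (v0 : v != 0) : point K :=
  exist (fun V => is_true (\dim V == 1%N)) <[v]>%VS
        (introT eqP (etrans (dim_vline v) (congr1 nat_of_bool v0))).

(** * The rational points of the curve *)

Section Curve.
Variables (n : nat) (F : finFieldType) (K : closedFieldType).
Variable iota : {rmorphism F -> K}.
Hypothesis hF : #|F| = (2 ^ n)%N.
Let q := (2 ^ n)%N.

Lemma F_char2 : 2%N \in [pchar F].
Proof. exact: card_finPcharP hF _. Qed.

Lemma K_char2 : 2%N \in [pchar K].
Proof. by rewrite (fmorph_pchar iota) F_char2. Qed.

Lemma n_gt0 : (0 < n)%N.
Proof. by rewrite -(@ltn_exp2l 2) // -hF finNzRing_gt1. Qed.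

Lemma frobenius_iota w : iota w ^+ q = iota w.
Proof. by rewrite -rmorphXn /= /q -hF expf_card. Qed.

Lemma frobenius_add (x y : K) : (x + y) ^+ q = x ^+ q + y ^+ q.
Proof. exact: frobeniusD K_char2 _ _ _. Qed.

Lemma sqrt_exists (c : F) : exists d, d ^+ 2 = c.
Proof.
exists (c ^+ (2 ^ n.-1)).
by rewrite -exprM -expnSr prednK ?n_gt0 // -hF expf_card.
Qed.

(** Membership in the curve, expressed on a vector that represents the
    point. *)
Definition on_curve (v : 'rV[K]_3) :=
  exists s t : K, (s, t) != (0, 0) /\ (<[v]> = <[Phi q s t]>)%VS.

Lemma on_curve_infinite x z :
  (x, z) != (0, 0) -> on_curve (map_mx iota (vec x 0 z)).
Proof.
rewrite map_vec rmorph0.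
have [-> z0|x0 _] := eqVneq x 0.
  exists 0, 1; split; first by rewrite -pair_eqE /= oner_eq0 andbF.
  rewrite PhiE !expr1n !expr0n expn_eq0 /= !mul0r addr0 rmorph0.
  rewrite -(@vline_scale _ _ (iota z) (vec 0 0 1)).
    by rewrite scale_vec !mulr0 mulr1.
  by rewrite fmorph_eq0; apply: contraNneq z0 => ->.
have [t tt] := sqrt_exists (z / x).
exists 1, (iota t); split; first by rewrite -pair_eqE /= oner_eq0.
rewrite PhiE !expr1n exprS frobenius_iota !mul1r addrr_pchar2 ?K_char2 //.
rewrite -(@vline_scale _ _ (iota x) (vec 1 0 _)) ?fmorph_eq0 //.
by rewrite scale_vec mulr1 mulr0 -!rmorphM -expr2 tt mulrCA divff // mulr1.
Qed.

(** A root a of T^2 + T = x z lies outside F, so Frobenius maps it to the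
    other root a + 1; the parameter is t = a / x, and its conjugate is
    t^q = (a + 1) / x. *)
Lemma node_parameter x z : x * z \notin artin_schreier F ->
  exists t k, [/\ k != 0, t ^+ q != t, (t ^+ q) ^+ q = t &
    map_mx iota (vec x 1 z) = k *: Phi q 1 t].
Proof.
rewrite map_vec rmorph1 => xz; have x0 : x != 0.
  apply: contraNneq xz => ->; rewrite mul0r.
  by have := artin_schreier_mem (0 : F); rewrite expr0n addr0.
have [a aa] := artin_schreier_solvable (iota (x * z)).
have aq : a ^+ q = a + 1.
  have [] // := @artin_schreier_roots _ (a ^+ q) a K_char2.
    by rewrite aa exprAC -frobenius_add aa frobenius_iota.
  rewrite /q -hF => /(fixed_by_frobenius iota)[w aw].
  case/negP: xz; suff -> : x * z = w ^+ 2 + w by apply: artin_schreier_mem.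
  by apply: (fmorph_inj iota); rewrite -aa aw rmorphD rmorphXn.
have tq : (iota x^-1 * a) ^+ q = iota x^-1 * (a + 1).
  by rewrite exprMn frobenius_iota aq.
have ix : iota x * iota x^-1 = 1 by rewrite -rmorphM divff // rmorph1.
exists (iota x^-1 * a), (iota x); split; first by rewrite fmorph_eq0.
- rewrite tq -subr_eq0 -mulrBr addrAC subrr add0r mulr1.
  by rewrite fmorph_eq0 invr_eq0.
- rewrite tq exprMn frobenius_iota frobenius_add expr1n aq -addrA.
  by rewrite addrr_pchar2 ?K_char2 // addr0.
rewrite PhiE !expr1n exprS tq !mul1r scale_vec mulr1; congr vec.
  rewrite -mulrDr mulrA ix mul1r addrA addrr_pchar2 ?add0r //; exact: K_char2.
rewrite [RHS](_ : _ = iota x * iota x^-1 * (iota x^-1 * (a ^+ 2 + a))); last by ring.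
by rewrite ix aa mul1r -rmorphM mulKf.
Qed.

(** If x z = w^2 + w with w in F, then a = x t / s is w or w + 1, so t / s is in
    F; but then s^q t and s t^q coincide and the middle coordinate of
    Phi(s, t) is 0. *)
Lemma on_curve_affine x z :
  on_curve (map_mx iota (vec x 1 z)) <-> x * z \notin artin_schreier F.
Proof.
split=> [[s [t [st0 Pv]]]|/node_parameter [t [k [k0 _ _ ->]]]]; last first.
  exists 1, t; split; first by rewrite -pair_eqE /= oner_eq0.
  exact: vline_scale.
move: Pv; rewrite map_vec rmorph1 => Pv.
have v0 : vec (iota x) 1 (iota z) != 0 by rewrite vec_eq0 oner_eq0 andbF.
have [k k0] := vline_eq v0 Pv; rewrite PhiE scale_vec => /vec_inj[xE yE zE].
apply/imsetP => -[w _ xzw].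
have s0 : s != 0.
  apply/eqP => s0; move/eqP: yE.
  by rewrite s0 expr0n expn_eq0 !mul0r addr0 mulr0 oner_eq0.
have x0 : iota x != 0 by rewrite xE mulf_neq0 ?expf_neq0.
(* This is the element a above, as iota x = k * s ^+ q.+1. *)
have [c ac] : exists c, k * s ^+ q * t = iota c.
  have aw : (k * s ^+ q * t) ^+ 2 + k * s ^+ q * t = iota w ^+ 2 + iota w.
    rewrite -rmorphXn -rmorphD -xzw rmorphM xE zE.
    rewrite -[in X in _ + X](mulr1 (k * _ * t)) yE.
    apply: (char2_eq K_char2 (z := (k * s ^+ q * t) ^+ 2)).
    by rewrite !exprS; ring.
  have [->|->] := artin_schreier_roots K_char2 aw; first by exists w.
  by exists (w + 1); rewrite rmorphD rmorph1.
have ts : t = iota (c / x) * s.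
  apply: (mulfI x0); rewrite mulrA -rmorphM mulrCA divff -?(fmorph_eq0 iota) // mulr1.
  by rewrite -ac xE exprS; ring.
move/eqP: yE; rewrite ts exprMn frobenius_iota (_ : _ + _ = 0).
  by rewrite mulr0 oner_eq0.
by apply: (char2_eq K_char2 (z := iota (c / x) * s * s ^+ q)); ring.
Qed.

(** * Singular points *)

Lemma Phi_neq0 (s t : K) : (s, t) != (0, 0) -> Phi q s t != 0.
Proof.
rewrite -pair_eqE /= negb_and PhiE vec_eq0 !expf_eq0 /= => /orP[/negPf->|/negPf->] //.
by rewrite !andbF.
Qed.

Lemma vanishes_on_curve f :
  (forall r : point K, ballico_hefez q r -> vanishes_at f r) ->
  forall k s t, (s, t) != (0, 0) -> k != 0 -> f.@[(k *: Phi q s t) ord0] = 0.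
Proof.
move=> fB k s t st0 k0; have Pst := Phi_neq0 st0.
apply: (fB (point_of Pst)); first by exists s, t.
  by rewrite memvZ ?memv_line.
by rewrite scaler_eq0 negb_or k0.
Qed.

(** At Phi(1, t) = Phi(1, t^q) the curve has the two tangent vectors (0, 1, t^q)
    and (0, 1, t).  They are independent, and together with the vector of the
    point, whose first coordinate is nonzero, they span the whole space; so the
    differential of f is zero. *)
Lemma singular_node (p : point K) t :
  t ^+ q != t -> (t ^+ q) ^+ q = t -> sval p = <[Phi q 1 t]>%VS ->
  singular (ballico_hefez q) p.
Proof.
move=> tqt tqq pE.
have nz1 u : (1, u) != (0, 0) :> K * K by rewrite -pair_eqE /= oner_eq0.
split; first by exists 1, t.
move=> d f _ /vanishes_on_curve fB i v; rewrite pE => /vlineP[k ->].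
rewrite scaler_eq0 negb_or => /andP[k0 _].
have tq_Phi : Phi q 1 (t ^+ q) = Phi q 1 t.
  by rewrite !PhiE !expr1n !mul1r tqq addrC !exprS tqq mulrC.
have q0 : q%:R = 0 :> K.
  by rewrite natrX (pcharf0 K_char2) expr0n eqn0Ngt n_gt0.
(* The scaling by k makes g pass through the given representative vector. *)
pose g (i : 'I_3) : {poly K} :=
  k%:P * ([:: 1%:P; 'X + 'X^q; 'X^(q.+1)] : seq {poly K})`_i.
have gE u : (fun i => (g i).[u]) =1 (k *: Phi q 1 u) ord0.
  by apply: ord3P; rewrite PhiE scale_vec vecE /g /= !hornerE ?expr1n ?mul1r ?mulr1.
pose D i := f^`M(i).@[(k *: Phi q 1 t) ord0].
have tangent u : Phi q 1 u = Phi q 1 t -> D 1 + D 2 * u ^+ q = 0.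
  move=> ut; apply: (mulfI k0); rewrite mulr0.
  have := @tangent_to_zero_locus K 3 f g u.
  rewrite big_ord3 /D -ut.
  rewrite !(meval_eq _ (gE u)) => <-.
    rewrite /g /= !derivM !derivC derivD derivX deriv_Xq // deriv_XqS //.
    by rewrite addr0 !hornerE /=; ring.
  by move=> w _; rewrite (meval_eq _ (gE w)) fB.
have D2 : D 2 = 0.
  have /eqP : D 2 * (t ^+ q - t) = 0.
    transitivity (D 1 + D 2 * t ^+ q - (D 1 + D 2 * (t ^+ q) ^+ q)).
      by rewrite tqq; ring.
    by rewrite !tangent // subrr.
  by rewrite mulf_eq0 subr_eq0 (negPf tqt) orbF => /eqP.
have D1 : D 1 = 0 by have := tangent t erefl; rewrite D2 mul0r addr0.
have D0 : D 0 = 0.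
  (* The line through the origin and the point: h 1 is the point itself. *)
  pose h (j : 'I_3) : {poly K} := ((k *: Phi q 1 t) ord0 j)%:P * 'X.
  have hE u : (fun j => (h j).[u]) =1 ((u * k) *: Phi q 1 t) ord0.
    by move=> j; rewrite /h !hornerE -scalerA [RHS]mxE mulrC.
  have /eqP : D 0 * k = 0.
    rewrite -[RHS](@tangent_to_zero_locus K 3 f h 1) => [|u u0]; last first.
      by rewrite (meval_eq _ (hE u)) fB // mulf_neq0.
    rewrite big_ord3 !(meval_eq _ (hE 1)) mul1r -/(D 0) -/(D 1) -/(D 2) D1 D2.
    by rewrite !mul0r !addr0 /h !derivE !hornerE /= PhiE scale_vec vecE expr1n !mulr1.
  by rewrite mulf_eq0 (negPf k0) orbF => /eqP.
by move: i; apply: ord3P.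
Qed.

(** Eliminating t from Y = t + t^q and Z = t^(q+1) on the chart X = 1 gives this
    equation of the curve. *)
Definition curve_equation : {mpoly K[3]} :=
  'X_1 ^+ q.+1 + 'X_0 ^+ q * 'X_2 + 'X_0 * 'X_2 ^+ q +
  \sum_(i < n) ('X_0 * 'X_2) ^+ (2 ^ i) * 'X_1 ^+ (2 ^ n - 2 ^ i.+1).+1.

Lemma curve_equation_homog : curve_equation \is q.+1.-homog.
Proof.
have hX (i : 'I_3) m : ('X_i ^+ m : {mpoly K[3]}) \is m.-homog.
  by rewrite -[X in X.-homog]mul1n; apply: dhomogMn; rewrite dhomogX /= mdeg1.
have X1 (i : 'I_3) := hX i 1%N.
have XZ : ('X_0 * 'X_2 : {mpoly K[3]}) \is 2.-homog := dhomogM (X1 0) (X1 2).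
rewrite /curve_equation !rpredD //.
- by have := dhomogM (hX 0 q) (X1 2); rewrite addn1.
- by have := dhomogM (X1 0) (hX 2 q); rewrite add1n.
apply: rpred_sum => i _.
have := dhomogM (dhomogMn (2 ^ i) XZ) (hX 1 (2 ^ n - 2 ^ i.+1).+1).
by rewrite -expnS addnS subnKC // leq_exp2l.
Qed.

Lemma curve_equationE (v : 'I_3 -> K) : curve_equation.@[v] =
  v 1 ^+ q.+1 + v 0 ^+ q * v 2 + v 0 * v 2 ^+ q +
  \sum_(i < n) (v 0 * v 2) ^+ (2 ^ i) * v 1 ^+ (2 ^ n - 2 ^ i.+1).+1.
Proof.
rewrite /curve_equation !mevalD !mevalM !rmorphXn /= !mevalXU; congr (_ + _).
rewrite rmorph_sum; apply: eq_bigr => i _.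
by rewrite rmorphM !rmorphXn /= mevalM !mevalXU.
Qed.

(** With a = s^q t and b = s t^q one has X Z = a b and Y = a + b, so the sum over
    i is a^q b + a b^q. *)
Lemma curve_equation_Phi s t : curve_equation.@[Phi q s t ord0] = 0.
Proof.
rewrite curve_equationE PhiE !vecE.
rewrite (_ : s ^+ q.+1 * t ^+ q.+1 = (s ^+ q * t) * (s * t ^+ q)); last first.
  by rewrite !exprS; ring.
rewrite artin_schreier_sum ?K_char2 //.
rewrite -/q (exprS (_ + _)) frobenius_add !exprMn !(exprS s) !(exprS t) !exprMn.
move: (s ^+ q) (t ^+ q) => a b; move: (a ^+ q) (b ^+ q) => a' b'.
apply: (char2_eq K_char2
  (z := a * a' * t * b + s * a * b * b' + a * a * t * b' + s * a' * b * b)).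
ring.
Qed.

Lemma curve_equation_vanishes (r : point K) :
  ballico_hefez q r -> vanishes_at curve_equation r.
Proof.
move=> [s [t [_ rE]]] v; rewrite rE => /vlineP[k ->] _.
rewrite -[RHS](mulr0 (k ^+ q.+1)) -(curve_equation_Phi s t).
rewrite -mevalZ_homog ?curve_equation_homog //.
by apply: meval_eq => i; rewrite mxE.
Qed.

(** The partial derivatives of the equation in X and Z, read off by letting
    one of these coordinates vary with Y = 0 fixed, are z^q and x^q. *)
Lemma smooth_infinite (p : point K) x z :
  (x, z) != (0, 0) -> sval p = <[vec x 0 z]>%VS ->
  ~ singular (ballico_hefez q) p.
Proof.
move=> xz0 pE [_ /(_ _ _ curve_equation_homog curve_equation_vanishes) sing].
have v0 : vec x 0 z != 0.
  by rewrite vec_eq0 eqxx /=; move: xz0; rewrite -pair_eqE.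
have grad0 i : curve_equation^`M(i).@[vec x 0 z ord0] = 0.
  by apply: sing => //; rewrite pE memv_line.
have q0 : q%:R = 0 :> K.
  by rewrite natrX (pcharf0 K_char2) expr0n eqn0Ngt n_gt0.
(* Every exponent of Y in the equation is positive. *)
have restr (g : 'I_3 -> {poly K}) : g 1 = 0 ->
    mmap polyC g curve_equation = g 0 ^+ q * g 2 + g 0 * g 2 ^+ q.
  move=> g1; rewrite /curve_equation !mmapD !rmorphM !rmorphXn /= !mmapX !mmap1U g1.
  rewrite expr0n add0r rmorph_sum big1 ?addr0 // => i _.
  by rewrite rmorphM !rmorphXn /= !mmapX !mmap1U g1 expr0n mulr0.
have dir0 (g : 'I_3 -> {poly K}) t : (fun i => (g i).[t]) =1 vec x 0 z ord0 ->
    (mmap polyC g curve_equation)^`().[t] = 0.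
  move=> gt; rewrite deriv_mmap horner_sum big1 // => i _.
  by rewrite hornerM horner_mmap (meval_eq _ gt) grad0 mul0r.
have x0 : x = 0.
  pose g (i : 'I_3) : {poly K} := ([:: x%:P; 0; 'X] : seq {poly K})`_i.
  have := dir0 g z; rewrite restr // /g /= derivD !derivM derivC.
  rewrite -polyC_exp derivC deriv_Xq // derivX !mul0r !mulr0 !addr0 add0r mulr1.
  rewrite hornerC => xq; apply/eqP.
  suff: x ^+ q == 0 by rewrite expf_eq0 => /andP[].
  by apply/eqP/xq; apply: ord3P; rewrite vecE !hornerE.
have z0 : z = 0.
  pose g (i : 'I_3) : {poly K} := ([:: 'X; 0; z%:P] : seq {poly K})`_i.
  have := dir0 g x; rewrite restr // /g /= derivD !derivM derivC.
  rewrite -polyC_exp derivC deriv_Xq // derivX !mul0r !mulr0 !addr0 add0r mul1r.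
  rewrite hornerC => xq; apply/eqP.
  suff: z ^+ q == 0 by rewrite expf_eq0 => /andP[].
  by apply/eqP/xq; apply: ord3P; rewrite vecE !hornerE.
by rewrite x0 z0 eqxx in xz0.
Qed.

End Curve.

(** * Points and lines in normal form *)

Section Plane.
Variable K : fieldType.
Implicit Types u v : 'rV[K]_3.

Lemma point_of_scale u v (u0 : u != 0) (v0 : v != 0) k :
  u = k *: v -> point_of u0 = point_of v0.
Proof.
move=> uv; apply: val_inj; rewrite /= uv vline_scale //.
by apply: contraNneq u0 => k0; rewrite uv k0 scale0r.
Qed.

Definition line_eq u : 'Hom('rV[K]_3, 'rV[K]_1) :=
  linfun (mulmxr u^T : {linear 'rV[K]_3 -> 'rV[K]_1}).

Lemma mem_line_eq a b c x y z :
  (vec x y z \in lker (line_eq (vec a b c))) = (a * x + b * y + c * z == 0).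
Proof.
rewrite memv_ker lfunE /=; apply/eqP/eqP => [/rowP/(_ 0)|e].
  by rewrite !mxE big_ord3 !mxE ![_ * a]mulrC ![_ * b]mulrC ![_ * c]mulrC.
apply/rowP => i; rewrite !ord1 mxE [RHS]mxE -[RHS]e big_ord3 !mxE.
by rewrite ![_ * a]mulrC ![_ * b]mulrC ![_ * c]mulrC.
Qed.

Lemma dim_line_eq u : u != 0 -> \dim (lker (line_eq u)) == 2.
Proof.
have [a [b [c ->]]] : exists a b c, u = vec a b c by do 3!eexists; exact: rV3_vec.
move=> u0; set f := line_eq _.
have : (\dim (lker f) + \dim (limg f) = 3)%N.
  by have := limg_ker_dim f fullv; rewrite capfv dimvf.
suff -> : \dim (limg f) = 1%N by rewrite addn1 => -[->].
apply/eqP; rewrite eqn_leq (leq_trans (dimvS (subvf _))) ?dimvf //=.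
rewrite lt0n dimv_eq0 -lkerE; apply: contraNN u0 => /subvP f0.
have ker x y z : a * x + b * y + c * z == 0.
  by rewrite -mem_line_eq f0 ?memvf.
move: (ker 1 0 0) (ker 0 1 0) (ker 0 0 1).
by rewrite !mulr0 !mulr1 !addr0 !add0r vec_eq0 => -> -> ->.
Qed.

Definition line_of u (u0 : u != 0) : line K :=
  exist (fun V => is_true (\dim V == 2)) (lker (line_eq u)) (dim_line_eq u0).

Lemma incidentE a b c x y z (u0 : vec a b c != 0) (v0 : vec x y z != 0) :
  incident (point_of v0) (line_of u0) = (a * x + b * y + c * z == 0).
Proof. by rewrite /incident /= -memvE mem_line_eq. Qed.

(** A nonzero u that is orthogonal to a basis of l exists because the basis has
    only 2 elements in a space of dimension 3. *)
Lemma line_of_surj (l : line K) :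
  exists a b c (u0 : vec a b c != 0), l = line_of u0.
Proof.
case: l => V V2; pose A := \matrix_(i < 3, j < \dim V) (vbasis V)`_j ord0 i.
have /rowV0Pn[u /sub_kermxP uA u0] : kermx A != 0.
  rewrite -mxrank_eq0 mxrank_ker subn_eq0 -ltnNge.
  by rewrite (leq_ltn_trans (rank_leq_col A)) // (eqP V2).
have := u0; rewrite [u]rV3_vec => w0; exists (u ord0 0), (u ord0 1), (u ord0 2), w0.
apply/val_inj/eqP; rewrite /= eqEdim (eqP V2) (eqP (dim_line_eq w0)) andbT.
rewrite -rV3_vec -(span_basis (vbasisP V)); apply/span_subvP => v /(nthP 0)[j].
rewrite size_tuple => jV <-; rewrite memv_ker lfunE /=; apply/eqP/rowP => i.
have := congr1 (fun M : 'rV_(\dim V) => M ord0 (Ordinal jV)) uA.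
rewrite !ord1 !mxE => uv; rewrite -[RHS]uv; apply: eq_bigr => k _.
by rewrite !mxE mulrC.
Qed.

Lemma line_of_scale u v (u0 : u != 0) (v0 : v != 0) k :
  u = k *: v -> line_of u0 = line_of v0.
Proof.
move=> uv; have k0 : k != 0.
  by apply: contraNneq u0 => k0; rewrite uv k0 scale0r.
apply/val_inj/vspaceP => w /=; rewrite !memv_ker !lfunE /= uv linearZ /=.
by rewrite -scalemxAr scaler_eq0 (negPf k0).
Qed.

Lemma point_of_surj (p : point K) : exists v (v0 : v != 0), p = point_of v0.
Proof.
have p0 : vpick (sval p) != 0 by rewrite vpick0 -dimv_eq0 (eqP (svalP p)).
exists (vpick (sval p)), p0; apply/val_inj/esym/eqP; rewrite /= eqEdim.
by rewrite -memvE memv_pick (eqP (svalP p)) dim_vline p0.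
Qed.

Lemma affine_neq0 (x z : K) : vec x 1 z != 0.
Proof. by rewrite vec_eq0 oner_eq0 andbF. Qed.

Definition affine_point x z : point K := point_of (affine_neq0 x z).

(** The points of the line Y = 0, which is taken as the line at infinity of
    the chart Y = 1. *)
Definition inf_vec (o : option K) := if o is Some x then vec x 0 1 else vec 1 0 0.

Lemma inf_neq0 o : inf_vec o != 0.
Proof. by case: o => [x|]; rewrite vec_eq0 oner_eq0 ?andbF. Qed.

Definition inf_point o : point K := point_of (inf_neq0 o).

(** Normal forms of the coefficient vectors of lines: the first coefficient of
    X, Z, Y, in this order, that is nonzero is scaled to 1. *)
Definition line_vec (i : K * K + option K) :=
  match i with
  | inl (b, c) => vec 1 b c
  | inr (Some b) => vec 0 b 1
  | inr None => vec 0 1 0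
  end.

Lemma line_vec_neq0 i : line_vec i != 0.
Proof. by case: i => [[b c]|[b|]]; rewrite vec_eq0 oner_eq0 ?andbF. Qed.

Definition norm_line i : line K := line_of (line_vec_neq0 i).

Lemma point_cases (p : point K) :
  (exists x z, p = affine_point x z) \/ (exists o, p = inf_point o).
Proof.
have [v [v0 ->]] := point_of_surj p; move: (v0); rewrite [v]rV3_vec.
move: (v _ 0) (v _ 1) (v _ 2) => x y z {v v0} v0.
have [y0|y0] := eqVneq y 0; last first.
  left; exists (x / y), (z / y); apply: (@point_of_scale _ _ _ _ y).
  by rewrite scale_vec mulr1 ![y * _]mulrC !divfK.
right; have [z0|z0] := eqVneq z 0; last first.
  exists (Some (x / z)); apply: (@point_of_scale _ _ _ _ z).
  by rewrite scale_vec mulr1 mulr0 y0 mulrC divfK.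
exists None; apply: (@point_of_scale _ _ _ _ x).
by rewrite scale_vec mulr1 mulr0 y0 z0.
Qed.

Lemma incident_affine i x z :
  incident (affine_point x z) (norm_line i) =
  (line_vec i ord0 0 * x + line_vec i ord0 1 + line_vec i ord0 2 * z == 0).
Proof.
have [a [b [c e]]] : exists a b c, line_vec i = vec a b c.
  by do 3!eexists; exact: rV3_vec.
rewrite /norm_line; move: (line_vec_neq0 i); rewrite e => u0.
by rewrite incidentE !vecE mulr1.
Qed.

Lemma incident_inf i o :
  incident (inf_point o) (norm_line i) =
  (if o is Some x then line_vec i ord0 0 * x + line_vec i ord0 2 == 0
   else line_vec i ord0 0 == 0).
Proof.
have [a [b [c e]]] : exists a b c, line_vec i = vec a b c.
  by do 3!eexists; exact: rV3_vec.
rewrite /norm_line; move: (line_vec_neq0 i); rewrite e => u0.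
by case: o => [x|]; rewrite incidentE !vecE !mulr0 !mulr1 !addr0.
Qed.

Lemma norm_line_surj l : exists i, l = norm_line i.
Proof.
have [a [b [c [u0 ->]]]] := line_of_surj l.
have [a0|a0] := eqVneq a 0; last first.
  exists (inl (b / a, c / a)); apply: (@line_of_scale _ _ _ _ a).
  by rewrite scale_vec mulr1 ![a * _]mulrC !divfK.
have [c0|c0] := eqVneq c 0; last first.
  exists (inr (Some (b / c))); apply: (@line_of_scale _ _ _ _ c).
  by rewrite scale_vec mulr1 mulr0 a0 mulrC divfK.
exists (inr None); apply: (@line_of_scale _ _ _ _ b).
by rewrite scale_vec mulr1 mulr0 a0 c0.
Qed.

Lemma norm_line_inj : injective norm_line.
Proof.
move=> i j ij; have A x z : incident (affine_point x z) (norm_line i) =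
    incident (affine_point x z) (norm_line j) by rewrite ij.
have I o : incident (inf_point o) (norm_line i) = incident (inf_point o) (norm_line j).
  by rewrite ij.
case: i j A I {ij} => [[b c]|[b|]] [[b' c']|[b'|]] A I //.
- have := A (- b) 0; have := I (Some (- c)).
  rewrite !incident_affine !incident_inf !vecE.
  by rewrite !mul1r !mulr0 !addr0 !addNr !eqxx ![- _ + _]addrC !subr_eq0 =>
    /esym/eqP -> /esym/eqP ->.
- by have := I None; rewrite !incident_inf !vecE eqxx oner_eq0.
- by have := I None; rewrite !incident_inf !vecE eqxx oner_eq0.
- by have := I None; rewrite !incident_inf !vecE eqxx oner_eq0.
- have := A 0 (- b); rewrite !incident_affine !vecE !mulr0 !mul1r !add0r subrr eqxx.
  by rewrite subr_eq0 => /esym/eqP ->.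
- by have := I (Some 0); rewrite !incident_inf !vecE !mulr0 !add0r eqxx oner_eq0.
- by have := I None; rewrite !incident_inf !vecE eqxx oner_eq0.
- by have := I (Some 0); rewrite !incident_inf !vecE !mulr0 !add0r eqxx oner_eq0.
Qed.

Lemma affine_point_inj x z x' z' :
  affine_point x z = affine_point x' z' -> x = x' /\ z = z'.
Proof.
move=> /(congr1 sval)/(vline_eq (affine_neq0 x z))[k _].
by rewrite scale_vec mulr1 => /vec_inj[-> <- ->]; rewrite !mul1r.
Qed.

Lemma inf_point_inj : injective inf_point.
Proof.
move=> o o' /(congr1 sval)/(vline_eq (inf_neq0 o))[k k0].
case: o o' => [x|] [x'|] //; rewrite scale_vec ?mulr0 ?mulr1 => /vec_inj[].
- by move=> -> _ <-; rewrite mul1r.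
- by move=> _ _ /eqP; rewrite oner_eq0.
- by move=> _ _ /esym/eqP; rewrite (negPf k0).
Qed.

Lemma affine_inf_neq x z o : affine_point x z <> inf_point o.
Proof.
move=> /(congr1 sval)/(vline_eq (affine_neq0 x z))[k _].
by case: o => [x'|]; rewrite scale_vec !mulr0 => /vec_inj[_ /eqP]; rewrite oner_eq0.
Qed.

End Plane.

(** * Counting the rational points on the lines *)

Section Counting.
Variables (n : nat) (F : finFieldType) (K : closedFieldType).
Variable iota : {rmorphism F -> K}.
Hypothesis hF : #|F| = (2 ^ n)%N.
Let q := (2 ^ n)%N.
Let F2 : 2%N \in [pchar F] := F_char2 hF.
Let B : point K -> Prop := @ballico_hefez K q.
Let BF := rat_points iota B.

(** The definition of map_point goes through the vector chosen by vpick; any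
    other representative of the point gives the same image. *)
Lemma map_point_of (v : 'rV[F]_3) (v0 : v != 0) :
  sval (map_point iota (point_of v0)) = <[map_mx iota v]>%VS.
Proof.
rewrite /= -(vline_scale _ (k := 1)) ?oner_eq0 // scale1r.
have w0 : vpick <[v]>%VS != 0 by rewrite vpick0 -dimv_eq0 dim_vline v0.
have /vlineP[k kE] := memv_pick <[v]>%VS.
rewrite kE map_mxZ vline_scale // fmorph_eq0.
by apply: contraNneq w0 => k0; rewrite kE k0 scale0r.
Qed.

Lemma rat_point_of (v : 'rV[F]_3) (v0 : v != 0) :
  (point_of v0 \in BF) = `[< on_curve n (map_mx iota v) >].
Proof. by rewrite inE /B /ballico_hefez map_point_of. Qed.

Lemma rat_inf o : inf_point o \in BF.
Proof.
rewrite rat_point_of; apply/asboolP.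
case: o => [x|] /=; apply: (on_curve_infinite iota hF);
  by rewrite -pair_eqE /= oner_eq0 ?andbF.
Qed.

Lemma rat_affine x z :
  (affine_point x z \in BF) = (x * z \notin artin_schreier F).
Proof.
rewrite rat_point_of.
by apply/asboolP/idP => /(on_curve_affine iota hF).
Qed.

Lemma sing_inf o : inf_point o \notin rat_sing iota B.
Proof.
rewrite inE; apply/asboolP; case: o => [x|].
  apply: (@smooth_infinite _ _ _ iota hF _ (iota x) 1).
    by rewrite -pair_eqE /= oner_eq0 andbF.
  by rewrite map_point_of map_vec rmorph0 rmorph1.
apply: (@smooth_infinite _ _ _ iota hF _ 1 0).
  by rewrite -pair_eqE /= oner_eq0.
by rewrite map_point_of map_vec rmorph0 rmorph1.
Qed.

Lemma sing_affine x z :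
  affine_point x z \in BF -> affine_point x z \in rat_sing iota B.
Proof.
rewrite rat_affine => /(node_parameter iota hF)[t [k [k0 tqt tqq vE]]].
rewrite inE; apply/asboolP; apply: (singular_node iota hF tqt tqq).
by rewrite map_point_of vE vline_scale.
Qed.

Lemma smoothE : BF :\: rat_sing iota B = [set inf_point o | o : option F].
Proof.
apply/setP => p; rewrite inE; apply/andP/imsetP => [[ns pB]|[o _ ->]].
  have [[x [z pE]]|[o ->]] := point_cases p; last by exists o.
  by rewrite pE in ns pB; rewrite (sing_affine pB) in ns.
by rewrite sing_inf rat_inf.
Qed.

(** The common shape of the counts: the line l has one point at infinity and
    affine points g m, of which those with k * m outside the subgroup of index
    2 are on the curve. *)
Lemma card_line_points (l : line F) o k (g : F -> point F) :
  injective g -> (forall m, inf_point o <> g m) ->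
  (forall p, incident p l <-> p = inf_point o \/ exists m, p = g m) ->
  (forall m, (g m \in BF) = (k * m \notin artin_schreier F)) ->
  #|[set p in BF | incident p l]| = if k == 0 then 1%N else (q %/ 2 + 1)%N.
Proof.
move=> g_inj go lE gB.
have -> : [set p in BF | incident p l] =
    inf_point o |: g @: [set m | k * m \notin artin_schreier F].
  apply/setP => p; rewrite !inE; apply/andP/orP => [[pB /lE[->|[m pE]]]|].
  - by left.
  - by right; rewrite pE imset_f // inE -gB -pE inE.
  case=> [/eqP->|/imsetP[m]].
    by split; [have := rat_inf o; rewrite inE | apply/lE; left].
  rewrite inE -gB inE => mB ->; split => //.
  by apply/lE; right; exists m.
rewrite cardsU1 card_imset // card_scaled_not_artin_schreier // hF.
rewrite (_ : inf_point o \notin _); last by apply/imsetP => -[m _ /go].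
by case: eqP => _ //; rewrite add1n addn1.
Qed.

Definition line_count (i : F * F + option F) :=
  match i with
  | inl (b, c) => if b ^+ 2 == c then 1%N else (q %/ 2 + 1)%N
  | inr (Some b) => if b == 0 then 1%N else (q %/ 2 + 1)%N
  | inr None => (q + 1)%N
  end.

(** For x = b + c z with c = d^2, x z = b z + (d z)^2 is congruent to (b + d) z
    modulo the elements w^2 + w, and b + d = 0 if and only if b^2 = c.  On the
    line z = b the product x z = b x is linear to begin with. *)
Lemma card_norm_line (i : F * F + option F) :
  #|[set p in BF | incident p (norm_line i)]| = line_count i.
Proof.
case: i => [[b c]|[b|]] /=.
- have [d dc] := sqrt_exists hF c.
  rewrite (@card_line_points _ (Some c) (b + d) (fun m => affine_point (b + c * m) m)).
  + by rewrite -dc eqf_sqr addr_eq0 !(oppr_pchar2 F2) orbb.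
  + by move=> m m' /affine_point_inj[].
  + by move=> m /esym/affine_inf_neq.
  + move=> p; split=> [|[->|[m ->]]].
    * have [[x [z ->]]|[o ->]] := point_cases p.
        rewrite incident_affine !vecE mul1r -addrA addr_eq0 (oppr_pchar2 F2).
        by move=> /eqP ->; right; exists z.
      rewrite incident_inf !vecE; case: o => [x|]; last by rewrite oner_eq0.
      by rewrite mul1r addr_eq0 (oppr_pchar2 F2) => /eqP ->; left.
    * by rewrite incident_inf !vecE mul1r (addrr_pchar2 F2).
    by rewrite incident_affine !vecE mul1r -addrA (addrr_pchar2 F2).
  move=> m; rewrite rat_affine.
  rewrite (_ : (b + d) * m = (b + c * m) * m + ((d * m) ^+ 2 + d * m)).
    by rewrite artin_schreierD.
  by rewrite -dc; apply/esym/(char2_eq F2 (z := d ^+ 2 * m ^+ 2)); ring.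
- rewrite (@card_line_points _ None b (fun m => affine_point m b)).
  + by [].
  + by move=> m m' /affine_point_inj[].
  + by move=> m /esym/affine_inf_neq.
  + move=> p; split=> [|[->|[m ->]]].
    * have [[x [z ->]]|[o ->]] := point_cases p.
        rewrite incident_affine !vecE mul0r mul1r add0r addr_eq0 (oppr_pchar2 F2).
        by move=> /eqP ->; right; exists x.
      rewrite incident_inf !vecE; case: o => [x|]; last by left.
      by rewrite mul0r add0r oner_eq0.
    * by rewrite incident_inf !vecE.
    by rewrite incident_affine !vecE mul0r mul1r add0r (addrr_pchar2 F2).
  by move=> m; rewrite rat_affine mulrC.
rewrite (_ : [set _ in _ | _] = [set inf_point o | o : option F]).
  by rewrite card_imset ?card_option ?hF ?addn1 //; exact: (@inf_point_inj F).
apply/setP => p; rewrite inE; apply/andP/imsetP => [[pB pl]|[o _ ->]].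
  have [[x [z pE]]|[o ->]] := point_cases p; last by exists o.
  by move: pl; rewrite pE incident_affine !vecE !mul0r addr0 add0r oner_eq0.
by rewrite rat_inf incident_inf; case: o => [x|]; rewrite !vecE ?mul0r ?addr0.
Qed.

Lemma tauE j : tau BF j = #|[set i | line_count i == j]|.
Proof.
rewrite /tau -(on_card_preimset (f := @norm_line F)).
  by apply: eq_card => i; rewrite !inE card_norm_line.
apply: onW_bij; exists (fun l => projT1 (cid (norm_line_surj l))) => [i|l].
  by case: cid => j' /= e; apply/esym/norm_line_inj.
by case: cid => j' /= ->.
Qed.

Lemma q2_double : (q %/ 2 + q %/ 2 = q)%N.
Proof.
rewrite addnn -muln2 divnK // /q; have := n_gt0 hF.
by case: (n) => // m _; rewrite expnS dvdn_mulr.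
Qed.

Lemma q2_gt0 : (0 < q %/ 2)%N.
Proof.
have : (0 < q)%N by rewrite expn_gt0.
by rewrite -{1}q2_double addnn double_gt0.
Qed.

Lemma tau_values j :
  tau BF j <> 0%N -> j = 1%N \/ j = (q %/ 2 + 1)%N \/ j = (q + 1)%N.
Proof.
move=> /eqP; rewrite tauE -lt0n => /card_gt0P[i]; rewrite inE => /eqP <-.
case: i => [[b c]|[b|]] /=; [case: ifP | case: ifP |]; by auto.
Qed.

(** The points (1, d, d^2) and (0, 0, 1) of the conic b^2 = a c in the dual
    plane. *)
Definition conic_line (o : option F) : F * F + option F :=
  if o is Some d then inl (d, d ^+ 2) else inr (Some 0).

Lemma line_count_eq1 :
  [set i | line_count i == 1%N] = [set conic_line o | o : option F].
Proof.
have [h2 h0] := (q2_double, q2_gt0).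
apply/setP => i; rewrite inE; apply/eqP/imsetP => [|[[d|] _ ->]]; last 2 first.
- by rewrite /= eqxx.
- by rewrite /= eqxx.
case: i => [[b c]|[b|]] /=; last by lia.
- by case: eqP => [<- _|_]; [exists (Some b) | lia].
- by case: eqP => [-> _|_]; [exists None | lia].
Qed.

Lemma line_count_eq_full : [set i | line_count i == (q + 1)%N] = [set inr None].
Proof.
have [h2 h0] := (q2_double, q2_gt0).
apply/setP => i; rewrite !inE; apply/eqP/eqP => [|->] //.
by case: i => [[b c]|[b|]] //=; case: ifP => _; lia.
Qed.

Lemma line_count_eq_half : [set i | line_count i == (q %/ 2 + 1)%N] =
  ~: ([set i | line_count i == 1%N] :|: [set i | line_count i == (q + 1)%N]).
Proof.
have [h2 h0] := (q2_double, q2_gt0).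
apply/setP => i; rewrite !inE.
by case: i => [[b c]|[b|]] //=; try case: ifP => _; lia.
Qed.

Lemma tau_1 : tau BF 1 = (q + 1)%N.
Proof.
rewrite tauE line_count_eq1 card_imset ?card_option ?hF ?addn1 //.
by move=> [d|] [d'|] // [-> _].
Qed.

Lemma tau_full : tau BF (q + 1) = 1%N.
Proof. by rewrite tauE line_count_eq_full cards1. Qed.

Lemma tau_half : tau BF (q %/ 2 + 1) = (q ^ 2 - 1)%N.
Proof.
have card_lines : #|{: F * F + option F}| = (q ^ 2 + q + 1)%N.
  by rewrite card_sum card_prod card_option hF addn1 addnS.
rewrite tauE line_count_eq_half cardsCs setCK cardsU -!tauE tau_1 tau_full card_lines.
rewrite line_count_eq1 line_count_eq_full (_ : _ :&: _ = set0) ?cards0; first by lia.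
by apply/setP => i; rewrite !inE; apply/andP => -[/imsetP[[d|] _ ->]].
Qed.
End Counting.

Theorem proposition4p1 (q n : nat) (hq : q = (2 ^ n)%N)
    (F : finFieldType) (hF : #|F| = q)
    (K : closedFieldType) (iota : {rmorphism F -> K})
    (hK : integralRange iota) :
  let B : point K -> Prop := @ballico_hefez K q in
  let BF : {set point F} := rat_points iota B in
  let smooth : {set point F} := BF :\: rat_sing iota B in
  (#|smooth| = (q + 1)%N /\ collinear smooth) /\
  (forall i : nat, tau BF i <> 0%N ->
     i = 1%N \/ i = (q %/ 2 + 1)%N \/ i = (q + 1)%N) /\
  (tau BF 1 = (q + 1)%N /\
   tau BF (q %/ 2 + 1) = (q ^ 2 - 1)%N /\
   tau BF (q + 1) = 1%N).
Proof.
subst q; move=> B BF smooth; split; last first.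
  split; first exact: tau_values.
  by split; [exact: tau_1 | split; [exact: tau_half | exact: tau_full]].
rewrite /smooth /BF /B smoothE //; split.
  by rewrite card_imset ?card_option ?hF ?addn1 //; exact: (@inf_point_inj F).
exists (norm_line (inr None)) => _ /imsetP[o _ ->].
by rewrite incident_inf; case: o => [x|]; rewrite !vecE ?mul0r ?addr0.
Qed.
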